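(* In the infinite-horizon setting described in the context, suppose that the channel transition matrix $Q$ is stochastically monotone and that $\mathbb U$ is a finite set $\mathbb U=\{0,u^{(1)},\dots,u^{(m)}\}$ (with $u^{(0)}=0$). For any $i\in\{0,1,\dots,m\}$ define $$k^{(i)}_\beta(s)=\inf\{e\in\mathbb R_{\ge0}:\tilde f_\beta(e,s)=u^{(i)}\},$$ and define $k^{(m+1)}_\beta(s)=\infty$. (Note that $k^{(0)}_\beta(s)=0$ and, since $\tilde f_\beta(\cdot,s)$ is even and quasi-convex, $k^{(i)}_\beta(s)\le k^{(i+1)}_\beta(s)$ for any $i\in\{0,1,\dots,m\}$.) Then the optimal strategy is a threshold-based strategy: for any $s\in\mathbb S$, $i\in\{0,\dots,m\}$ and $|e|\in\big[k^{(i)}_\beta(s),k^{(i+1)}_\beta(s)\big)$, $$\tilde f_\beta(e,s)=u^{(i)}.$$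
   Context: $\beta\in(0,1]$. $\mathbb X$ is $\mathbb Z$ or $\mathbb R$; $a\in\mathbb X$; $\{W_t\}$ i.i.d. $\mathbb X$-valued with symmetric and unimodal distribution $\mu$ (pdf if $\mathbb X=\mathbb R$, pmf if $\mathbb X=\mathbb Z$). $\mathbb S=\{1,\dots,n\}$ is the ordered set of channel states (larger = better) with transition matrix $Q$; $Q$ is stochastically monotone if for all $i>j$ and any $\ell\in\{0,\dots,n-1\}$, $\sum_{k=\ell+1}^nQ_{ik}\ge\sum_{k=\ell+1}^nQ_{jk}$. The power levels $\mathbb U\subset\mathbb R_{\ge0}$ are listed in increasing order $0<u^{(1)}<\dots<u^{(m)}$. The packet-drop probability $p(s,u)$ is weakly decreasing in $u$ and decreasing in $s$, with $p(s,0)=1$. The transmission cost $\lambda$ is weakly increasing, $\lambda(0)=0$, and finite at the maximum power; the distortion $d$ is even and quasi-convex, $d(0)=0$. Error dynamics: given $E_t=e$, $S_{t-1}=s$, $U_t=u$, $S_t=s'$ with probability $Q_{ss'}$; then $E_{t+1}=ae+W_t$ with probability $p(s',u)$ (packet dropped) and $E_{t+1}=W_t$ with probability $1-p(s',u)$ (packet received). For $\beta\in(0,1)$, $J_\beta$ is the smallest bounded solution of $$J_\beta(e,s)=\min_{u\in\mathbb U}\Big\{(1-\beta)\Big[\lambda(u)+\sum_{s'\in\mathbb S}Q_{ss'}p(s',u)d(e)\Big]+\beta\,\mathbb E[J_\beta(E_{t+1},S_t)\mid E_t=e,S_{t-1}=s,U_t=u]\Big\},$$ and $\tilde f_\beta(e,s)$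 is the arg min of the right-hand side, an optimal time-homogeneous transmission strategy $U_t=\tilde f_\beta(E_t,S_{t-1})$ for the discounted problem; for $\beta=1$ (long-run average cost), $\tilde f_1$ is a limit point of $\{\tilde f_\beta\}_{\beta\in(0,1)}$ as $\beta\uparrow1$, which is optimal. Under stochastic monotonicity of $Q$, $\tilde f_\beta(e,s)$ is even and quasi-convex in $e$ for every $s$. Standing (bounded-distortion) assumption: for the given $\beta\in(0,1]$, under the strategy that always transmits at the maximum power, for all $e\in\mathbb X$ and $s\in\mathbb S$ the expected distortion is finite, where the expected distortion is $(1-\beta)\mathbb E[\sum_{t=0}^\infty\beta^td(E_t)\mid E_0=e,S_{-1}=s]$ for $\beta\in(0,1)$ and $\lim_{T\to\infty}\frac1T\mathbb E[\sum_{t=0}^{T-1}d(E_t)\mid E_0=e,S_0=s]$ for $\beta=1$.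
   Formalization: For X=R, the claim at |e|=k^(i)(s) is made only if f̃(·,s) is right-continuous there (else false); if the level u^(i) is never used, k^(i)(s) is set to k^(i+1)(s) instead of inf ∅=∞; ties in the arg min are broken consistently. *)

(* Defs.v *)
From HB Require Import structures.
From mathcomp Require Import all_boot all_order all_algebra.
From mathcomp Require Import all_classical all_reals all_analysis.

Set Implicit Arguments.
Unset Strict Implicit.
Unset Printing Implicit Defensive.

Import Order.TTheory GRing.Theory Num.Theory.
Import numFieldNormedType.Exports.

Local Open Scope classical_set_scope.
Local Open Scope ring_scope.

(* The error space X is Z or R.  Both are treated as subsets of R: every
   function of the error has domain R, but only its values on X matter. *)
Inductive error_space := Integers | Reals.

Definition points (R : realType) (X : error_space) : set R :=
  match X with
  | Integers => range (fun z : int => z%:~R)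
  | Reals => setT
  end.
Arguments points : clear implicits.

(* The data of the problem, with n ordered channel states (indexed from 0) and
   m.+1 power levels.  As the transmission cost is increasing and finite at the
   largest power, it is finite on all power levels, hence real-valued. *)
Record model (R : realType) (n m : nat) := Model {
  err_space : error_space;
  gain : R;
  noise : probability (measurableTypeR R) R;
  trans : 'M[R]_n;
  power : 'I_m.+1 -> R;
  pdrop : 'I_n -> R -> R;
  txcost : R -> R;
  distortion : R -> R
}.

Definition even_on (R : realType) (A : set R) (T : Type) (g : R -> T) : Prop :=
  forall x, A x -> g (- x) = g x.

Definition quasi_convex_on (R : realType) (A : set R) (g : R -> R) : Prop :=
  forall x y z, A x -> A y -> A z -> x <= y <= z -> g y <= Num.max (g x) (g z).

(* g is the pdf (X = R) or pmf (X = Z) of P. *)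
Definition has_density (R : realType) (X : error_space)
    (P : probability (measurableTypeR R) R) (g : R -> R) : Prop :=
  match X with
  | Integers => P (points R Integers) = 1%E /\
      forall z : int, P [set z%:~R] = (g z%:~R)%:E
  | Reals => measurable_fun [set: R] g /\
      forall A : set R, measurable A ->
        P A = (\int[lebesgue_measure]_(x in A) (g x)%:E)%E
  end.

Definition symmetric_unimodal (R : realType) (X : error_space)
    (P : probability (measurableTypeR R) R) : Prop :=
  exists g : R -> R,
    [/\ forall x, points R X x -> 0 <= g x,
        even_on (points R X) g,
        forall x y, points R X x -> points R X y -> 0 <= x <= y -> g y <= g x &
        has_density X P g].

Definition stochastic (R : realType) (n : nat) (Q : 'M[R]_n) : Prop :=
  (forall i j, 0 <= Q i j) /\ (forall i, \sum_j Q i j = 1).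

(* With states indexed from 0, the tail sum from l+1 to n becomes l <= k. *)
Definition stochastically_monotone (R : realType) (n : nat) (Q : 'M[R]_n) :
    Prop :=
  forall i j l : 'I_n, (j < i)%N ->
    \sum_(k < n | (l <= k)%N) Q j k <= \sum_(k < n | (l <= k)%N) Q i k.

Definition max_power (R : realType) (n m : nat) (M : model R n m) : R :=
  power M ord_max.

Definition standing_assumptions (R : realType) (n m : nat)
    (M : model R n m) : Prop :=
  [/\ points R (err_space M) (gain M),
      symmetric_unimodal (err_space M) (noise M),
      stochastic (trans M),
      power M ord0 = 0 /\
        (forall i j : 'I_m.+1, (i < j)%N -> power M i < power M j) &
  [/\ [/\ forall s i, 0 <= pdrop M s (power M i) <= 1,
          forall s (i j : 'I_m.+1), (i <= j)%N ->
            pdrop M s (power M j) <= pdrop M s (power M i),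
          forall (s s' : 'I_n) i, (s <= s')%N ->
            pdrop M s' (power M i) <= pdrop M s (power M i) &
          forall s, pdrop M s 0 = 1],
      txcost M 0 = 0 /\
        (forall i j : 'I_m.+1, (i <= j)%N ->
           txcost M (power M i) <= txcost M (power M j)) &
      [/\ even_on (points R (err_space M)) (distortion M),
          quasi_convex_on (points R (err_space M)) (distortion M) &
          distortion M 0 = 0]]].

(* E[J(E_{t+1}, S_t) | E_t = e, S_t = s', U_t = u].  The convention 0 * +oo = 0
   agrees with ignoring an event of probability zero. *)
Definition expect_error (R : realType) (n m : nat) (M : model R n m)
    (J : R -> 'I_n -> \bar R) (e : R) (s' : 'I_n) (u : R) : \bar R :=
  ((pdrop M s' u)%:E *
     (\int[noise M]_(w in points R (err_space M)) J (gain M * e + w)%R s') +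
   (1 - pdrop M s' u)%:E *
     (\int[noise M]_(w in points R (err_space M)) J w s'))%E.

(* E[J(E_{t+1}, S_t) | E_t = e, S_{t-1} = s, U_t = u]. *)
Definition expect_next (R : realType) (n m : nat) (M : model R n m)
    (J : R -> 'I_n -> \bar R) (e : R) (s : 'I_n) (u : R) : \bar R :=
  (\sum_(s' < n) (trans M s s')%:E * expect_error M J e s' u)%E.

(* E[d(E_t) | E_0 = e, S_{-1} = s] when the maximum power is always used. *)
Definition max_power_dist (R : realType) (n m : nat) (M : model R n m)
    (t : nat) : R -> 'I_n -> \bar R :=
  iter t (fun D e s => expect_next M D e s (max_power M))
       (fun e _ => (distortion M e)%:E).

(* E[d(E_t) | E_0 = e, S_0 = s] when the maximum power is always used; here the
   conditioning is on the channel state at time 0, not at time -1. *)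
Definition max_power_dist0 (R : realType) (n m : nat) (M : model R n m)
    (t : nat) (e : R) (s : 'I_n) : \bar R :=
  match t with
  | 0 => (distortion M e)%:E
  | t'.+1 => expect_error M (max_power_dist M t') e s (max_power M)
  end.

(* Since d >= 0, the expectation of the (possibly infinite) sum is the sum of
   the expectations. *)
Definition bounded_distortion (R : realType) (n m : nat) (M : model R n m)
    (beta : R) : Prop :=
  forall e s, points R (err_space M) e ->
    (beta < 1 ->
       ((1 - beta)%:E *
          \sum_(0 <= t <oo) ((beta ^+ t)%:E * max_power_dist M t e s)
        < +oo)%E) /\
    (beta = 1 ->
       exists l : R,
         ((T%:R^-1)%:E * (\sum_(t < T) max_power_dist0 M t e s))%E
           @[T --> \oo] --> l%:E).

Definition bellman_rhs (R : realType) (n m : nat) (M : model R n m) (beta : R)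
    (J : R -> 'I_n -> R) (e : R) (s : 'I_n) (u : R) : \bar R :=
  (((1 - beta) * (txcost M u +
      \sum_(s' < n) trans M s s' * pdrop M s' u * distortion M e))%:E +
   beta%:E * expect_next M (fun e' s' => (J e' s')%:E) e s u)%E.

(* A nonnegative real-valued solution of the dynamic program.  Finiteness at
   each point replaces boundedness in the supremum norm, which fails for
   unbounded d.  When a sup-norm bounded solution exists, it is unique by
   contraction, and is the smallest solution in the present sense. *)
Definition bellman_solution (R : realType) (n m : nat) (M : model R n m)
    (beta : R) (J : R -> 'I_n -> R) : Prop :=
  [/\ forall e s, points R (err_space M) e -> 0 <= J e s,
      forall s, measurable_fun (points R (err_space M)) (J ^~ s) &
      forall e s, points R (err_space M) e ->
        (J e s)%:E =
        \big[Order.min/+oo%E]_(i < m.+1) bellman_rhs M beta J e s (power M i)].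

Definition smallest_solution (R : realType) (n m : nat) (M : model R n m)
    (beta : R) (J : R -> 'I_n -> R) : Prop :=
  bellman_solution M beta J /\
  forall J', bellman_solution M beta J' ->
    forall e s, points R (err_space M) e -> J e s <= J' e s.

Definition minimizer (R : realType) (n m : nat) (M : model R n m) (beta : R)
    (J : R -> 'I_n -> R) (e : R) (s : 'I_n) (u : R) : Prop :=
  (exists i, u = power M i) /\
  forall i, (bellman_rhs M beta J e s u <=
             bellman_rhs M beta J e s (power M i))%E.

(* "The" arg min: a minimizer at every (e, s), with ties broken consistently:
   if two powers are both minimizers at e and at e', the same one is not
   preferred at e and rejected for the other at e'.  Any fixed order of
   priority on the powers (e.g. always the smallest, or always the largest
   minimizer) satisfies this, and it is void if minimizers are unique. *)
Definition arg_min_strategy (R : realType) (n m : nat) (M : model R n m)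
    (beta : R) (J : R -> 'I_n -> R) (f : R -> 'I_n -> R) : Prop :=
  (forall e s, points R (err_space M) e -> minimizer M beta J e s (f e s)) /\
  (forall e e' s, points R (err_space M) e -> points R (err_space M) e' ->
     minimizer M beta J e s (f e' s) -> minimizer M beta J e' s (f e s) ->
     f e s = f e' s).

Definition discounted_strategy (R : realType) (n m : nat) (M : model R n m)
    (beta : R) (f : R -> 'I_n -> R) : Prop :=
  exists2 J, smallest_solution M beta J & arg_min_strategy M beta J f.

(* f is a limit point of F b as b increases to 1, for the topology of pointwise
   convergence on X x S (neighbourhoods constrain finitely many points). *)
Definition limit_point_at1 (R : realType) (n : nat) (A : set R)
    (F : R -> R -> 'I_n -> R) (f : R -> 'I_n -> R) : Prop :=
  forall (r : seq (R * 'I_n)) (eps b0 : R), 0 < eps -> b0 < 1 ->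
    (forall x, x \in r -> A x.1) ->
    exists b, [/\ b0 < b, 0 < b, b < 1 &
      forall x, x \in r -> `|F b x.1 x.2 - f x.1 x.2| < eps].

(* f is the strategy f~_beta. *)
Definition optimal_strategy (R : realType) (n m : nat) (M : model R n m)
    (beta : R) (f : R -> 'I_n -> R) : Prop :=
  (beta < 1 -> discounted_strategy M beta f) /\
  (beta = 1 -> exists F : R -> R -> 'I_n -> R,
     (forall b, 0 < b < 1 -> discounted_strategy M b (F b)) /\
     limit_point_at1 (points R (err_space M)) F f).

Definition level_set (R : realType) (n m : nat) (M : model R n m)
    (f : R -> 'I_n -> R) (s : 'I_n) (i : nat) : set (\bar R) :=
  [set e%:E | e in [set e | [/\ points R (err_space M) e, 0 <= e &
                                f e s = power M (inord i)]]].

(* threshold M f s i is k^(i)(s): k^(m+1)(s) = +oo, and for i <= m it is the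
   infimum of the i-th level set if this is nonempty and k^(i+1)(s) otherwise.
   With inf(empty) = +oo instead, a power level that f skips would break
   k^(i) <= k^(i+1). *)
Definition threshold (R : realType) (n m : nat) (M : model R n m)
    (f : R -> 'I_n -> R) (s : 'I_n) (i : nat) : \bar R :=
  foldr (fun j k => if level_set M f s j == set0 then k
                    else ereal_inf (level_set M f s j))
        +oo%E (iota i (m.+1 - i)).

Definition right_continuous_at (R : realType) (g : R -> R) (x : R) : Prop :=
  g y @[y --> x^'+] --> g x.

(* Main.v *)
(* The smallest solution J of the dynamic program is the limit of value
   iteration from 0.  Each iterate is even and nondecreasing in |e|: for a
   symmetric unimodal noise W, y |-> E[g(y + W)] inherits these properties from
   g, by averaging the integral with its image under the reflection
   x |-> y + y' - x and using a pointwise rearrangement inequality.  Hence J is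
   even and nondecreasing in |e|.  The power u enters the Bellman right-hand
   side only through the weights p(s', u), which decrease in u, so the same
   rearrangement inequality makes that right-hand side submodular in (|e|, u);
   with consistently broken ties, the minimizer is nondecreasing in |e|.  This
   monotonicity passes to pointwise limits, which covers beta = 1, and it makes
   the level sets of f ordered in |e|. *)
Require Import Defs.
From HB Require Import structures.
From mathcomp Require Import all_boot all_order all_algebra.
From mathcomp Require Import all_classical all_reals all_analysis.
From mathcomp Require Import measurable_realfun zify ring lra.

Set Implicit Arguments.
Unset Strict Implicit.
Unset Printing Implicit Defensive.

Import Order.TTheory GRing.Theory Num.Theory.
Import numFieldNormedType.Exports.
Import HBNNSimple.

Local Open Scope classical_set_scope.
Local Open Scope ring_scope.

(** * Densities and reflections *)

(** [nu] need not be sigma-finite: the counting measure on the reals is used below. The formula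
    comes from monotone convergence along simple functions, then linearity, down to the hypothesis
    on subsets of [D]. *)
Lemma ge0_integral_density d (T : measurableType d) (R : realType)
    (mu nu : {measure set T -> \bar R}) (D : set T) (phi : T -> R)
    (h : T -> \bar R) :
  measurable D -> measurable_fun D phi -> (forall x, D x -> 0 <= phi x) ->
  (forall A, measurable A -> A `<=` D ->
     mu A = (\int[nu]_(x in A) (phi x)%:E)%E) ->
  measurable_fun D h -> (forall x, D x -> (0 <= h x)%E) ->
  (\int[mu]_(x in D) h x = \int[nu]_(x in D) (h x * (phi x)%:E))%E.
Proof.
move=> mD mphi phi0 muE mh h0.
have mphi' : measurable_fun D (EFin \o phi) by exact/measurable_EFinP.
pose h_ := nnsfun_approx mD mh.
have cvgh x : D x -> (h_ n x)%:E @[n --> \oo] --> h x.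
  by move=> Dx; exact: cvg_nnsfun_approx.
have ndh x : {homo (fun n => (h_ n x)%:E) : n m / (n <= m)%N >-> (n <= m)%E}.
  by move=> n m nm; rewrite lee_fin; exact/lefP/nd_nnsfun_approx.
transitivity (limn (fun n => \int[mu]_(x in D) (h_ n x)%:E)%E).
  rewrite -monotone_convergence//.
  - by apply: eq_integral => x /[!inE] Dx; apply/esym/cvg_lim => //; exact: cvgh.
  - by move=> n; exact/measurable_EFinP/measurable_funTS.
  - by move=> n x _; rewrite lee_fin.
transitivity (limn (fun n => \int[nu]_(x in D) ((h_ n x)%:E * (phi x)%:E))%E);
    last first.
  rewrite -monotone_convergence//.
  - apply: eq_integral => x /[!inE] Dx; apply/cvg_lim => //.
    by apply: cvgeZr => //; exact: cvgh.
  - move=> n; apply: emeasurable_funM => //.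
    by exact/measurable_EFinP/measurable_funTS.
  - by move=> n x Dx; rewrite mule_ge0 ?lee_fin ?phi0.
  - by move=> x Dx n m nm; rewrite lee_wpmul2r ?lee_fin ?phi0//; exact: ndh.
congr (limn _); apply/funext => n.
transitivity (\sum_(k \in range (h_ n))
    \int[mu]_(x in D) (k * \1_(h_ n @^-1` [set k]) x)%:E)%E.
  under eq_integral do rewrite fimfunE -fsumEFin//.
  rewrite ge0_integral_fsum//.
  - by move=> y; apply/measurable_EFinP/measurable_funM.
  - by move=> y x _; rewrite nnfun_muleindic_ge0.
transitivity (\sum_(k \in range (h_ n))
    \int[nu]_(x in D) ((k * \1_(h_ n @^-1` [set k]) x)%:E * (phi x)%:E))%E;
    last first.
  under [RHS]eq_integral => x /[!inE] Dx.
    rewrite fimfunE -fsumEFin// ge0_mule_fsuml; last first.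
      by move=> y; rewrite nnfun_muleindic_ge0.
    over.
  rewrite ge0_integral_fsum//.
  - move=> y; apply: emeasurable_funM => //.
    by apply/measurable_EFinP/measurable_funM.
  - by move=> y x Dx; rewrite mule_ge0 ?nnfun_muleindic_ge0 ?lee_fin ?phi0.
apply: eq_fsbigr => r; rewrite inE => -[x0 _ hx0].
have r0 : 0 <= r by rewrite -hx0.
have mA : measurable (h_ n @^-1` [set r]) by [].
rewrite (integralZl_indic_nnsfun _ mD) integral_indic//.
under eq_integral do rewrite EFinM -muleA.
rewrite ge0_integralZl//; last 2 first.
- by apply: emeasurable_funM => //; exact/measurable_EFinP.
- by move=> x Dx; rewrite mule_ge0 ?lee_fin ?phi0.
congr (_ * _)%E.
rewrite muE; [|exact: measurableI|by apply: subIsetr].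
rewrite setIC integral_mkcondr; apply: eq_integral => x Dx.
by rewrite /patch indicE; case: ifP => _; rewrite ?mul1e ?mul0e.
Qed.

Lemma mule_rearrangement (R : realType) (a b : \bar R) (p q : R) :
  0 <= q -> q <= p -> (0 <= a)%E -> (a <= b)%E ->
  (a * p%:E + b * q%:E <= a * q%:E + b * p%:E)%E.
Proof.
move=> q0 qp; have p0 : 0 <= p by exact: le_trans qp.
case: a b => [a| |] [b| |] //; rewrite ?lee_fin => a0 ab.
- nra.
- move: q0; rewrite le_eqVlt => /orP[/eqP q0|q0]; last first.
    by rewrite !gt0_mulye ?lte_fin// ?(lt_le_trans q0)// !addey ?leey.
  move: p0; rewrite le_eqVlt => /orP[/eqP p0|p0]; first by rewrite -p0 -q0.
  by rewrite (@gt0_mulye _ p%:E) ?lte_fin// addey ?leey.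
- move: q0; rewrite le_eqVlt => /orP[/eqP q0|q0]; last first.
    by rewrite !gt0_mulye ?lte_fin// ?(lt_le_trans q0).
  move: p0; rewrite le_eqVlt => /orP[/eqP p0|p0]; first by rewrite -p0 -q0.
  by rewrite -q0 mule0 adde0 add0e.
Qed.

(** * Arithmetic and measurability of the error space *)

Section points.
Variables (R : realType) (X : error_space).

Lemma points0 : points R X 0.
Proof. by case: X => //=; exists 0. Qed.

Lemma pointsD x y : points R X x -> points R X y -> points R X (x + y).
Proof. by case: X => //= -[i _ <-] [j _ <-]; exists (i + j); rewrite ?intrD. Qed.

Lemma pointsN x : points R X x -> points R X (- x).
Proof. by case: X => //= -[i _ <-]; exists (- i); rewrite ?intrN. Qed.

Lemma pointsM x y : points R X x -> points R X y -> points R X (x * y).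
Proof. by case: X => //= -[i _ <-] [j _ <-]; exists (i * j); rewrite ?intrM. Qed.

Lemma points_norm x : points R X x -> points R X `|x|.
Proof. by move=> Xx; case: ger0P => // _; exact: pointsN. Qed.

Lemma countable_integers : countable (points R Integers).
Proof. by apply: sub_countable (countableP [set: int]); exact: card_image_le. Qed.

Lemma measurable_points : measurable (points R X : set (measurableTypeR R)).
Proof.
case: X => //=; apply: countable_measurable; last exact: countable_integers.
by move=> x; exact: measurable_set1.
Qed.

End points.

Lemma measurable_fun_integers (R : realType) d (T : measurableType d)
  (g : measurableTypeR R -> T) : measurable_fun (points R Integers) g.
Proof.
move=> _ B _; apply: countable_measurable; first by move=> x; exact: measurable_set1.
by apply: sub_countable (countable_integers R); exact: subset_card_le.
Qed.

(** * Reflections and the measures they preserve *)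

Definition reflect_at (R : realType) (c : R)
  (x : measurableTypeR R) : measurableTypeR R := c - x.

Lemma measurable_reflect_at (R : realType) (c : R) :
  measurable_fun setT (reflect_at c).
Proof. exact: measurable_funB. Qed.

HB.instance Definition _ (R : realType) (c : R) :=
  isMeasurableFun.Build _ _ _ _ (reflect_at c) (measurable_reflect_at c).

Lemma reflect_atK (R : realType) (c : R) : involutive (reflect_at c).
Proof. by move=> x; rewrite /reflect_at opprB addrC subrK. Qed.

Lemma reflect_at_points (R : realType) (X : error_space) (c : R) :
  points R X c -> reflect_at c @^-1` points R X = points R X.
Proof.
move=> Xc; have stable x : points R X x -> points R X (reflect_at c x).
  by move=> Xx; apply: pointsD => //; exact: pointsN.
by apply/seteqP; split=> x /= /stable; rewrite ?reflect_atK.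
Qed.

(** A reflected half-open interval is half-open at the other end and keeps its length; half-open
    intervals determine Lebesgue measure, so the pushforward coincides with it. *)
Lemma lebesgue_measure_reflect (R : realType) (c : R) (A : set R) :
  measurable A -> lebesgue_measure (reflect_at c @^-1` A) = lebesgue_measure A.
Proof.
move=> mA; apply/esym.
apply: (@lebesgue_measure_unique R (pushforward lebesgue_measure (reflect_at c)))
  => // _ [[a b]] _ <-.
rewrite /= /pushforward.
have -> : reflect_at c @^-1` `]a, b] = `[c - b, c - a[%classic.
  by apply/seteqP; split=> x /=; rewrite /reflect_at !in_itv /=; lra.
rewrite !lebesgue_measure_itv /= !lte_fin; have -> : (c - b < c - a) = (a < b).
  by apply/idP/idP; lra.
by case: ifP => // _; rewrite -!EFinB; congr _%:E; ring.
Qed.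

Lemma counting_reflect (R : realType) (c : R) (A : set R) :
  counting (reflect_at c @^-1` A) = counting A :> \bar R.
Proof.
have imE B : reflect_at c @^-1` B = reflect_at c @` B.
  apply/seteqP; split=> x /=.
    by move=> Bx; exists (reflect_at c x); rewrite ?reflect_atK.
  by move=> [y By <-]; rewrite reflect_atK.
have preK : reflect_at c @^-1` (reflect_at c @^-1` A) = A.
  by apply/seteqP; split=> x /=; rewrite reflect_atK.
have cardE : (reflect_at c @^-1` A #= A)%card.
  apply/card_eqPle; split; first by rewrite imE; exact: card_image_le.
  by rewrite -[X in (X #<= _)%card]preK imE; exact: card_image_le.
rewrite /counting; case: (pselect (finite_set A)) => fA.
  have fA' : finite_set (reflect_at c @^-1` A) by rewrite (eq_finite_set cardE).
  by rewrite !asboolT//; have /fcard_eq -> := cardE.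
by rewrite !asboolF// (eq_finite_set cardE).
Qed.

(** [A] is the disjoint union of the pieces [F k], where [F k] holds the integer of code [k] if
    there is one in [A] and is empty otherwise. Countable additivity turns both sides into the same
    series. *)
Lemma integers_density (R : realType) (P : probability (measurableTypeR R) R)
    (g : R -> R) (A : set R) :
  (forall z : int, 0 <= g z%:~R) ->
  (forall z : int, P [set z%:~R] = (g z%:~R)%:E) ->
  A `<=` points R Integers ->
  P A = (\int[@counting (measurableTypeR R) R]_(x in A) (g x)%:E)%E.
Proof.
move=> g0 Pg AZ.
pose F k : set (measurableTypeR R) :=
  [set x | A x /\ exists2 z : int, pickle z = k & x = z%:~R].
have FE k : F k = set0 \/ exists2 z : int, F k = [set z%:~R] & A z%:~R.
  have [[x [Ax [z zk xz]]]|F0] := pselect (F k !=set0); last first.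
    by left; apply/seteqP; split=> x // Fx; apply: F0; exists x.
  right; exists z; last by rewrite -xz.
  apply/seteqP; split=> y /=.
    by move=> [_ [z' + ->]]; rewrite -zk => /(pcan_inj pickleK) ->.
  by move=> ->; split; [rewrite -xz|exists z].
have mF k : measurable (F k).
  by have [->//|[z -> _]] := FE k; exact: measurable_set1.
have AE : A = \bigcup_k F k.
  apply/seteqP; split=> x /=.
    move=> Ax; have [z _ zx] := AZ _ Ax.
    by exists (pickle z) => //; split=> //; exists z.
  by move=> [k _ []].
have tF : trivIset setT F.
  move=> i j _ _ [x [[_ [z <- ->]] [_ [z' <- /eqP]]]].
  by rewrite eqr_int => /eqP ->.
have mg : measurable_fun (\bigcup_k F k) (fun x => (g x)%:E).
  rewrite -AE; apply: (measurable_funS _ AZ); first exact: measurable_points.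
  exact: measurable_fun_integers.
have mUF : measurable (\bigcup_k F k) by exact: bigcupT_measurable.
rewrite AE measure_semi_bigcup// ge0_integral_bigcup//; last first.
  by rewrite -AE => x /AZ [z _ <-]; rewrite lee_fin.
apply: eq_eseriesr => k _; have [->|[z -> _]] := FE k.
  by rewrite measure0 integral_set0.
transitivity (g z%:~R)%:E; first exact: Pg.
rewrite (eq_integral (cst (g z%:~R)%:E)); last by move=> x /[!inE] ->.
rewrite integral_cst; last exact: measurable_set1.
rewrite -[LHS]mule1; congr (_ * _)%E; apply/esym.
rewrite /= /counting asboolT; last exact: finite_set1.
by rewrite fset_set1 finmap.cardfs1.
Qed.

(** Puts integers and reals on one footing, with [nu] the counting or the Lebesgue measure.
    Invariance under reflections suffices, since two of them compose to a translation. *)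
Lemma reflection_invariant_density (R : realType) (X : error_space)
    (P : probability (measurableTypeR R) R) (g : R -> R) :
  (forall x, points R X x -> 0 <= g x) -> has_density X P g ->
  measurable_fun (points R X) g /\
  exists nu : {measure set (measurableTypeR R) -> \bar R},
    (forall A, measurable A -> A `<=` points R X ->
      P A = (\int[nu]_(x in A) (g x)%:E)%E) /\
    (forall c A, measurable A -> nu (reflect_at c @^-1` A) = nu A).
Proof.
case: X => /= [g0 [_ Pg]|g0 [mg Pg]].
  split; first exact: measurable_fun_integers.
  exists (@counting (measurableTypeR R) R); split=> [A mA AX|c A mA].
    by apply: integers_density => // z; apply: g0; exists z.
  exact: counting_reflect.
split=> //; exists lebesgue_measure; split=> [A mA _|c A mA]; first exact: Pg.
exact: lebesgue_measure_reflect.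
Qed.

Lemma integral_reflect (R : realType) (X : error_space)
    (nu : {measure set (measurableTypeR R) -> \bar R}) (c : R) (F : R -> \bar R) :
  (forall c A, measurable A -> nu (reflect_at c @^-1` A) = nu A) ->
  points R X c ->
  measurable_fun (points R X) F ->
  (forall x, points R X x -> (0 <= F x)%E) ->
  (\int[nu]_(x in points R X) F x = \int[nu]_(x in points R X) F (c - x)%R)%E.
Proof.
move=> nuE Xc mF F0.
transitivity (\int[pushforward nu (reflect_at c)]_(x in points R X) F x)%E.
  by apply: eq_measure_integral => A mA _; apply/esym; exact: nuE.
rewrite ge0_integral_pushforward//.
- by rewrite reflect_at_points.
- exact: measurable_points.
- by move=> x /[!inE]; exact: F0.
Qed.

(* Evenness and monotonicity in [`|x|] in a single condition. *)
Definition radial (R : realType) (X : error_space) (g : R -> \bar R) : Prop :=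
  forall x y, points R X x -> points R X y -> `|x| <= `|y| -> (g x <= g y)%E.

(** Where [g] stays below [c] is the trace on the error space of a symmetric interval. [C] is that
    interval, described through all errors of smaller absolute value so that it is convex in the
    reals even for integer errors. *)
Lemma radial_measurable (R : realType) (X : error_space) (g : R -> \bar R) :
  radial X g -> measurable_fun (points R X) g.
Proof.
move=> rg mX; apply: (measurability _ (ErealGenCInfty.measurableE R)) => //.
move=> _ [_ [c ->] <-].
pose C := [set x : R | forall y, points R X y -> `|y| <= `|x| -> (g y < c%:E)%E].
have -> : points R X `&` g @^-1` `[c%:E, +oo[ = points R X `\` C.
  apply/seteqP; split=> x [Xx]; rewrite /= in_itv /= andbT.
    by move=> cg; split=> // Cx; move: cg; rewrite leNgt Cx.
  move=> nC; split=> //; rewrite leNgt; apply/negP => gc; apply: nC => y Xy yx.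
  exact: le_lt_trans (rg _ _ Xy Xx yx) gc.
apply: measurableD => //; apply: is_interval_measurable => x z Cx Cz y.
move=> /andP[xy yz] w Xw wy.
have /orP[yx|yz'] : (`|y| <= `|x|) || (`|y| <= `|z|).
  by rewrite !ler_norml; case: (ger0P x) (ger0P z) => ? [] ?; lra.
- by apply: Cx => //; exact: le_trans yx.
- by apply: Cz => //; exact: le_trans yz'.
Qed.

(** The map x |-> y + y' - x exchanges y and y'. Of a point and its mirror image, the one closer to
    the origin is also closer to y: the differences of squares are (y + y')(y + y' - 2x) and (y' -
    y)(y + y' - 2x), whose product is nonnegative. *)
Lemma reflection_order (R : realType) (x y y' : R) : `|y| <= `|y'| ->
  (`|x| <= `|y + y' - x| /\ `|x - y| <= `|x - y'|) \/
  (`|y + y' - x| <= `|x| /\ `|x - y'| <= `|x - y|).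
Proof.
have sqr (a b : R) : (`|a| <= `|b|) = (a ^+ 2 <= b ^+ 2).
  by rewrite -[a ^+ 2]real_normK ?num_real// -[b ^+ 2]real_normK ?num_real// ler_sqr
     ?nnegrE.
rewrite !sqr => yy'.
pose p := (y + y' - x) ^+ 2 - x ^+ 2; pose q := (x - y') ^+ 2 - (x - y) ^+ 2.
have pq : 0 <= p * q.
  have -> : p * q = (y' ^+ 2 - y ^+ 2) * (y + y' - 2 * x) ^+ 2.
    by rewrite /p /q; ring.
  by rewrite mulr_ge0 ?sqr_ge0 ?subr_ge0.
rewrite -(subr_ge0 (x ^+ 2)) -(subr_ge0 ((x - y) ^+ 2)).
rewrite -(subr_le0 (x ^+ 2)) -(subr_le0 ((x - y) ^+ 2)) -/p -/q.
have [p0|p0|p0] := ltrgtP 0 p; have [q0|q0|q0] := ltrgtP 0 q;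
  try by [left; split|right; split].
- by rewrite leNgt pmulr_rlt0 ?q0 in pq.
- by rewrite leNgt nmulr_rlt0 ?q0 in pq.
Qed.

Lemma measurable_fun_shift (R : realType) (X : error_space) (c : R)
    (h : R -> \bar R) : points R X c ->
  measurable_fun (points R X) h ->
  measurable_fun (points R X) (fun x => h (c + x)).
Proof.
move=> Xc mh; have mX : measurable (points R X) by exact: measurable_points.
apply: (measurable_comp mX _ mh).
  by move=> _ [x Xx <-]; exact: pointsD.
exact: measurable_funD.
Qed.

Lemma measurable_fun_reflect (R : realType) (X : error_space) (c : R)
    (h : R -> \bar R) : points R X c ->
  measurable_fun (points R X) h ->
  measurable_fun (points R X) (fun x => h (c - x)).
Proof.
move=> Xc mh; have mX : measurable (points R X) by exact: measurable_points.
apply: (measurable_comp mX _ mh).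
  by move=> _ [x Xx <-]; apply: pointsD => //; exact: pointsN.
exact: measurable_funB.
Qed.

(** With z = y + y' - x, the integral at y is both that of g(x) phi(x - y) and that of g(z) phi(x -
    y'); exchanging y and y' gives two forms at y'. By [reflection_order], it is at y' that the
    larger value of g meets the larger value of phi. *)
Lemma radial_convolution (R : realType) (X : error_space)
    (P : probability (measurableTypeR R) R) (g : R -> \bar R) :
  symmetric_unimodal X P -> radial X g ->
  (forall x, points R X x -> (0 <= g x)%E) ->
  radial X (fun y => \int[P]_(w in points R X) g (y + w)%R)%E.
Proof.
move=> [phi [phi0 ephi dphi dens]] rg g0 y y' Xy Xy' yy'.
have [mphi [nu [PE nuE]]] := reflection_invariant_density phi0 dens.
pose D := points R X; have mD : measurable D by exact: measurable_points.
have rphi x z : D x -> D z -> `|x| <= `|z| -> phi z <= phi x.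
  have phi_norm t : D t -> phi `|t| = phi t.
    by move=> Dt; case: ger0P => // _; exact: ephi.
  move=> Dx Dz xz; rewrite -(phi_norm x)// -(phi_norm z)//.
  by apply: dphi; rewrite ?normr_ge0//; exact: points_norm.
have mg : measurable_fun D g by exact: radial_measurable.
have mphi' : measurable_fun D (EFin \o phi) by exact/measurable_EFinP.
have mgphi c : D c -> measurable_fun D (fun x => g (c + x)%R * (phi x)%:E)%E.
  by move=> Dc; apply: emeasurable_funM => //; exact: measurable_fun_shift.
have gphi0 c x : D c -> D x -> (0 <= g (c + x)%R * (phi x)%:E)%E.
  by move=> Dc Dx; rewrite mule_ge0 ?lee_fin ?phi0//; apply: g0; exact: pointsD.
have intE c : D c -> (\int[P]_(w in D) g (c + w)%R =
    \int[nu]_(w in D) (g (c + w)%R * (phi w)%:E))%E.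
  move=> Dc; apply: ge0_integral_density => //; first exact: measurable_fun_shift.
  by move=> x Dx; apply: g0; exact: pointsD.
have reflE b c : D b -> D c -> (\int[P]_(w in D) g (b + w)%R =
    \int[nu]_(x in D) (g (b + c - x)%R * (phi (x - c)%R)%:E))%E.
  move=> Db Dc; rewrite intE// (integral_reflect nuE Dc); last 2 first.
  - exact: mgphi.
  - by move=> x; exact: gphi0.
  apply: eq_integral => x /[!inE] Dx; rewrite addrA; congr (_ * _%:E)%E.
  by rewrite -ephi ?opprB//; apply: pointsD => //; exact: pointsN.
(* Reflections at 0 and then at [c] make up the translation by [c]; evenness of [phi] undoes the
   sign after each. *)
have shiftE c : D c -> (\int[P]_(w in D) g (c + w)%R =
    \int[nu]_(x in D) (g x * (phi (x - c)%R)%:E))%E.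
  move=> Dc.
  have mgc : measurable_fun D (fun x => g (c - x)%R) by exact: measurable_fun_reflect.
  have gc0 x : D x -> (0 <= g (c - x)%R)%E.
    by move=> Dx; apply: g0; apply: pointsD => //; exact: pointsN.
  rewrite intE// (integral_reflect nuE (points0 R X)); last 2 first.
  - exact: mgphi.
  - by move=> x; exact: gphi0.
  transitivity (\int[nu]_(x in D) (g (c - x)%R * (phi x)%:E))%E.
    by apply: eq_integral => x /[!inE] Dx; rewrite sub0r ephi.
  rewrite (integral_reflect nuE Dc); last 2 first.
  - by apply: emeasurable_funM => //; exact: measurable_fun_reflect.
  - by move=> x Dx; rewrite mule_ge0 ?lee_fin ?phi0 ?gc0.
  apply: eq_integral => x /[!inE] Dx; rewrite opprB addrC subrK.
  by rewrite -ephi ?opprB//; apply: pointsD => //; exact: pointsN.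
have mprod c h : measurable_fun D h -> D c ->
    measurable_fun D (fun x => h x * (phi (x - c)%R)%:E)%E.
  move=> mh Dc; apply: emeasurable_funM => //.
  apply: (eq_measurable_fun (fun x => (EFin \o phi) (- c + x))).
    by move=> x _; rewrite /= addrC.
  by apply: measurable_fun_shift => //; exact: pointsN.
have prod0 c h x : (forall x, D x -> (0 <= h x)%E) -> D c -> D x ->
    (0 <= h x * (phi (x - c)%R)%:E)%E.
  move=> h0 Dc Dx; rewrite mule_ge0 ?h0// lee_fin phi0//.
  by apply: pointsD => //; exact: pointsN.
have Ds : D (y + y') by exact: pointsD.
have msg : measurable_fun D (fun x => g (y + y' - x)) by exact: measurable_fun_reflect.
have sg0 x : D x -> (0 <= g (y + y' - x)%R)%E.
  by move=> Dx; apply: g0; apply: pointsD => //; exact: pointsN.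
(* Argued by contraposition, so that infinite integrals are covered. *)
have twice (a b : \bar R) : (a + a <= b + b -> a <= b)%E.
  by rewrite !leNgt; apply: contra => ba; exact: lteD.
(* The two reflected forms of each integral are added, and the sums compared
   pointwise. *)
apply: twice.
rewrite [X in (X + _ <= _)%E]shiftE// (reflE y y')// [X in (_ <= X + _)%E]shiftE//.
rewrite (reflE y' y)// (addrC y' y).
rewrite -!ge0_integralD//; first last.
- exact: mprod.
- by move=> x Dx; exact: (prod0 _ _ _ sg0).
- exact: mprod.
- by move=> x Dx; exact: (prod0 _ _ _ g0).
- exact: mprod.
- by move=> x Dx; exact: (prod0 _ _ _ sg0).
- exact: mprod.
- by move=> x Dx; exact: (prod0 _ _ _ g0).
apply: ge0_le_integral => //.
- by move=> x Dx; apply: adde_ge0; [exact: (prod0 _ _ _ g0)|exact: (prod0 _ _ _ sg0)].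
- by apply: emeasurable_funD; exact: mprod.
- by apply: emeasurable_funD; exact: mprod.
move=> x Dx.
have DB a b : D a -> D b -> D (a - b) by move=> ? /pointsN; exact: pointsD.
have [[gx px]|[gx px]] := reflection_order x yy'.
  by apply: mule_rearrangement; rewrite ?g0 ?phi0 ?rphi ?rg//; exact: DB.
rewrite addeC [leRHS]addeC.
by apply: mule_rearrangement; rewrite ?sg0 ?phi0 ?rphi ?rg//; exact: DB.
Qed.

(** * The Bellman operator *)

(* Convertible to [bellman_rhs] when V is real-valued. *)
Definition bellman_op (R : realType) (n m : nat) (M : model R n m) (b : R)
    (V : R -> 'I_n -> \bar R) (e : R) (s : 'I_n) (u : R) : \bar R :=
  (((1 - b) * (txcost M u +
      \sum_(s' < n) trans M s s' * pdrop M s' u * distortion M e))%:E +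
   b%:E * expect_next M V e s u)%E.

(** At e = 0 this is also the expected value after a successful reception, so it expresses both
    outcomes of a transmission. *)
Definition dropped_value (R : realType) (n m : nat) (M : model R n m)
    (V : R -> 'I_n -> \bar R) (e : R) (s : 'I_n) : \bar R :=
  (\int[noise M]_(w in points R (err_space M)) V (gain M * e + w)%R s)%E.

(** Collects everything in the Bellman right-hand side that depends on [e], for a given new channel
    state; the probability of a drop is its weight. *)
Definition dropped_cost (R : realType) (n m : nat) (M : model R n m) (b : R)
    (V : R -> 'I_n -> \bar R) (e : R) (s : 'I_n) : \bar R :=
  (((1 - b) * distortion M e)%:E + b%:E * dropped_value M V e s)%E.

(** The regularity of an arbitrary solution, before its symmetry and monotonicity are known. *)
Definition value_function (R : realType) (n m : nat) (M : model R n m)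
    (V : R -> 'I_n -> \bar R) : Prop :=
  (forall e s, points R (err_space M) e -> (0 <= V e s)%E) /\
  (forall s, measurable_fun
     (points R (err_space M)) (V ^~ s)).

Section bellman.
Variables (R : realType) (n m : nat) (M : model R n m) (b : R).
Hypothesis Mok : standing_assumptions M.
Hypothesis b01 : 0 < b < 1.
Local Notation X := (points R (err_space M)).
Implicit Types (V W : R -> 'I_n -> \bar R) (e : R) (s : 'I_n) (i j : 'I_m.+1).

Let b0 : 0 <= b. Proof. by case/andP: b01 => /ltW. Qed.
Let b1 : 0 <= 1 - b. Proof. by case/andP: b01 => _ /ltW; rewrite subr_ge0. Qed.

Let X0 : X 0. Proof. exact: points0. Qed.

Let trans_ge0 s s' : 0 <= trans M s s'.
Proof. by case: Mok => _ _ [+ _] _ _. Qed.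

Let pdrop_ge0 s i : 0 <= pdrop M s (power M i).
Proof. by case: Mok => _ _ _ _ [[/(_ s i)/andP[]]]. Qed.

Let pdrop_le1 s i : 0 <= 1 - pdrop M s (power M i).
Proof. by case: Mok => _ _ _ _ [[/(_ s i)/andP[]]]; rewrite subr_ge0. Qed.

Let pdrop_noninc s i j : (i <= j)%N ->
  pdrop M s (power M j) <= pdrop M s (power M i).
Proof. by case: Mok => _ _ _ _ [[_ + _ _] _ _]; exact. Qed.

Let gainX e : X e -> X (gain M * e).
Proof. by case: Mok => Xa _ _ _ _; exact: pointsM. Qed.

(** Quasi-convexity at 0, between -|z| and |z|, gives d >= 0; at |x|, between 0 and |y|, it then
    gives monotonicity. *)
Lemma distortion_radial x y : X x -> X y -> `|x| <= `|y| ->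
  distortion M x <= distortion M y.
Proof.
case: Mok => _ _ _ _ [_ _ [ed qd d0]] Xx Xy xy.
have d_norm z : X z -> distortion M `|z| = distortion M z.
  by move=> Xz; case: ger0P => // _; exact: ed.
have dge0 z : X z -> 0 <= distortion M `|z|.
  move=> Xz; have XN := pointsN (points_norm Xz).
  have := qd (- `|z|) 0 `|z| XN X0 (points_norm Xz).
  rewrite ed; last exact: points_norm.
  by rewrite maxxx d0; apply; rewrite oppr_le0 normr_ge0.
rewrite -(d_norm x)// -(d_norm y)//.
have := qd 0 `|x| `|y| X0 (points_norm Xx) (points_norm Xy).
by rewrite d0 (max_idPr (dge0 _ Xy)); apply; rewrite normr_ge0.
Qed.

Lemma distortion_ge0 x : X x -> 0 <= distortion M x.
Proof.
case: (Mok) => _ _ _ _ [_ _ [_ _ <-]] Xx.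
by apply: distortion_radial => //; rewrite normr0.
Qed.

Lemma txcost_ge0 i : 0 <= txcost M (power M i).
Proof.
case: Mok => _ _ _ [u0 _] [_ [c0 cE] _].
by rewrite -c0 -u0; exact: cE.
Qed.

Lemma measurable_shift V e s : value_function M V -> X e ->
  measurable_fun X
    (fun w => V (gain M * e + w) s).
Proof.
move=> [_ mV] Xe.
by apply: (@measurable_fun_shift _ _ _ (V ^~ s)) => //; exact: gainX.
Qed.

Lemma dropped_value_ge0 V e s : value_function M V -> X e ->
  (0 <= dropped_value M V e s)%E.
Proof.
move=> [V0 _] Xe; apply: integral_ge0 => w Xw.
by apply: V0; apply: pointsD => //; exact: gainX.
Qed.

Lemma dropped_cost_ge0 V e s : value_function M V -> X e ->
  (0 <= dropped_cost M b V e s)%E.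
Proof.
move=> vV Xe; rewrite adde_ge0//.
  by rewrite lee_fin mulr_ge0// distortion_ge0.
by rewrite mule_ge0 ?lee_fin// dropped_value_ge0.
Qed.

(** Separates the variables: [e] enters only through [dropped_cost], and the power only through its
    cost and the weights. As values may be infinite, products are distributed over sums by
    nonnegativity of the terms. *)
Lemma bellman_opE V e s i : value_function M V -> X e ->
  bellman_op M b V e s (power M i) =
  (((1 - b) * txcost M (power M i))%:E + \sum_(s' < n)
    ((trans M s s' * pdrop M s' (power M i))%:E * dropped_cost M b V e s' +
     (trans M s s' * (1 - pdrop M s' (power M i)))%:E *
       (b%:E * dropped_value M V 0%R s')))%E.
Proof.
move=> vV Xe; rewrite /bellman_op /expect_next mulrDr EFinD -addeA.
congr (_ + _)%E; rewrite mulr_sumr -sumEFin ge0_sume_distrr; last first.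
  move=> s' _; rewrite mule_ge0 ?lee_fin// adde_ge0// mule_ge0 ?lee_fin//.
    exact: dropped_value_ge0.
  by apply: integral_ge0 => w Xw; case: vV => V0 _; exact: V0.
rewrite -big_split /=; apply: eq_bigr => s' _; rewrite /expect_error.
have -> : (\int[noise M]_(w in X) V w s' = dropped_value M V 0%R s')%E.
  by rewrite /dropped_value; apply: eq_integral => w _; rewrite mulr0 add0r.
have Ae0 := dropped_value_ge0 s' vV Xe; have A00 := dropped_value_ge0 s' vV X0.
rewrite -/(dropped_value M V e s') /dropped_cost.
have p0 := pdrop_ge0 s' i; have q0 := pdrop_le1 s' i.
have d0 := distortion_ge0 Xe.
rewrite [in LHS]ge0_muleDr ?mule_ge0 ?lee_fin//.
rewrite [in LHS]ge0_muleDr ?mule_ge0 ?lee_fin//.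
rewrite [in RHS]ge0_muleDr ?mule_ge0 ?lee_fin ?mulr_ge0//.
rewrite addeA !muleA -!EFinM; congr (_%:E + _%:E * _ + _%:E * _)%E; ring.
Qed.

Let weight_ge0 s s' i : 0 <= trans M s s' * pdrop M s' (power M i).
Proof. by rewrite mulr_ge0. Qed.

Let weight'_ge0 s s' i : 0 <= trans M s s' * (1 - pdrop M s' (power M i)).
Proof. by rewrite mulr_ge0. Qed.

Lemma bellman_op_ge0 V e s i : value_function M V -> X e ->
  (0 <= bellman_op M b V e s (power M i))%E.
Proof.
move=> vV Xe; rewrite bellman_opE// adde_ge0//.
  by rewrite lee_fin mulr_ge0// txcost_ge0.
apply: sume_ge0 => s' _; rewrite adde_ge0// mule_ge0 ?lee_fin//.
  exact: dropped_cost_ge0.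
by rewrite mule_ge0 ?lee_fin// dropped_value_ge0.
Qed.

Lemma dropped_value_le V W e s : value_function M V -> value_function M W ->
  (forall e s, X e -> (V e s <= W e s)%E) -> X e ->
  (dropped_value M V e s <= dropped_value M W e s)%E.
Proof.
move=> vV vW VW Xe; have XD w : X w -> X (gain M * e + w).
  by move=> Xw; apply: pointsD => //; exact: gainX.
apply: ge0_le_integral.
- exact: measurable_points.
- by move=> w Xw; case: vV => V0 _; apply: V0; exact: XD.
- exact: measurable_shift.
- exact: measurable_shift.
- by move=> w Xw; apply: VW; exact: XD.
Qed.

Lemma bellman_op_le V W e s i : value_function M V -> value_function M W ->
  (forall e s, X e -> (V e s <= W e s)%E) -> X e ->
  (bellman_op M b V e s (power M i) <= bellman_op M b W e s (power M i))%E.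
Proof.
move=> vV vW VW Xe; rewrite !bellman_opE// leeD2l//.
apply: lee_sum => s' _; apply: leeD; rewrite lee_wpmul2l ?lee_fin//.
  by apply: leeD2l; rewrite lee_wpmul2l ?lee_fin// dropped_value_le.
by rewrite lee_wpmul2l ?lee_fin// dropped_value_le.
Qed.

Lemma dropped_value_radial V s : value_function M V ->
  (forall s, radial (err_space M) (V ^~ s)) ->
  radial (err_space M) (dropped_value M V ^~ s).
Proof.
move=> [V0 mV] rV x y Xx Xy xy; case: Mok => _ su _ _ _.
have := radial_convolution su (rV s) (V0 ^~ s).
apply => //; [exact: gainX|exact: gainX|].
by rewrite !normrM ler_wpM2l.
Qed.

Lemma dropped_cost_radial V s : value_function M V ->
  (forall s, radial (err_space M) (V ^~ s)) ->
  radial (err_space M) (dropped_cost M b V ^~ s).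
Proof.
move=> vV rV x y Xx Xy xy; apply: leeD.
  by rewrite lee_fin ler_wpM2l// distortion_radial.
by rewrite lee_wpmul2l ?lee_fin//; exact: dropped_value_radial.
Qed.

Lemma bellman_op_radial V s i : value_function M V ->
  (forall s, radial (err_space M) (V ^~ s)) ->
  radial (err_space M) (fun e => bellman_op M b V e s (power M i)).
Proof.
move=> vV rV x y Xx Xy xy; rewrite !bellman_opE// leeD2l//.
apply: lee_sum => s' _; apply: leeD2r; rewrite lee_wpmul2l ?lee_fin//.
exact: dropped_cost_radial.
Qed.

(** Transmission costs and reception terms, which do not involve the error, occur equally on both
    sides. What remains, for each new state, is [mule_rearrangement] applied to the drop weights of
    i and j and the dropped costs at e and e'. *)
Lemma bellman_op_submodular V e e' s i j : value_function M V ->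
  (forall s, radial (err_space M) (V ^~ s)) ->
  X e -> X e' -> `|e| <= `|e'| -> (i <= j)%N ->
  (bellman_op M b V e s (power M i) + bellman_op M b V e' s (power M j) <=
   bellman_op M b V e s (power M j) + bellman_op M b V e' s (power M i))%E.
Proof.
move=> vV rV Xe Xe' ee' ij; rewrite !bellman_opE//.
rewrite addeACA [leRHS]addeACA (addeC ((1 - b) * txcost M (power M j))%:E).
apply: leeD2l; rewrite -!big_split /=; apply: lee_sum => s' _.
rewrite addeACA [leRHS]addeACA [X in (_ <= _ + X)%E]addeC; apply: leeD2r.
rewrite ![(_%:E * dropped_cost _ _ _ _ _)%E]muleC.
apply: mule_rearrangement => //.
- by rewrite ler_wpM2l// pdrop_noninc.
- exact: dropped_cost_ge0.
- exact: dropped_cost_radial.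
Qed.

End bellman.

(** * Value iteration *)

Definition bellman_min (R : realType) (n m : nat) (M : model R n m) (b : R)
    (V : R -> 'I_n -> \bar R) (e : R) (s : 'I_n) : \bar R :=
  \big[Order.min/+oo%E]_(i < m.+1) bellman_op M b V e s (power M i).

Definition value_iter (R : realType) (n m : nat) (M : model R n m) (b : R)
    (k : nat) : R -> 'I_n -> \bar R :=
  iter k (bellman_min M b) (fun _ _ => 0%E).

Lemma bellman_min_le (R : realType) (n m : nat) (M : model R n m) (b : R)
    (V : R -> 'I_n -> \bar R) (e : R) (s : 'I_n) (i : 'I_m.+1) :
  (bellman_min M b V e s <= bellman_op M b V e s (power M i))%E.
Proof. exact: bigmin_le. Qed.

Lemma bellman_min_attained (R : realType) (n m : nat) (M : model R n m) (b : R)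
    (V : R -> 'I_n -> \bar R) (e : R) (s : 'I_n) :
  exists i, bellman_min M b V e s = bellman_op M b V e s (power M i).
Proof.
rewrite /bellman_min (bigmin_eq_arg _ ord0)//; first by eexists.
by move=> i _; exact: leey.
Qed.

Section value_iteration.
Variables (R : realType) (n m : nat) (M : model R n m) (b : R).
Hypothesis Mok : standing_assumptions M.
Hypothesis b01 : 0 < b < 1.
Local Notation X := (points R (err_space M)).
Implicit Types (V W : R -> 'I_n -> \bar R) (e : R) (s : 'I_n) (i j : 'I_m.+1).

Definition radial_value V := (forall e s, X e -> (0 <= V e s)%E) /\
  (forall s, radial (err_space M) (V ^~ s)).

Lemma radial_value_function V : radial_value V -> value_function M V.
Proof. by move=> [V0 rV]; split=> // s; exact: radial_measurable. Qed.

Lemma bellman_min_radial V : radial_value V -> radial_value (bellman_min M b V).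
Proof.
move=> rV; have vV := radial_value_function rV; split=> [e s Xe|s x y Xx Xy xy].
  by have [i ->] := bellman_min_attained M b V e s; exact: bellman_op_ge0.
have [i ->] := bellman_min_attained M b V y s.
apply: le_trans (bellman_min_le M b V x s i) _.
by case: rV => _ rV; exact: (bellman_op_radial Mok b01 s i vV rV).
Qed.

Lemma bellman_min_mono V W : value_function M V -> value_function M W ->
  (forall e s, X e -> (V e s <= W e s)%E) ->
  forall e s, X e -> (bellman_min M b V e s <= bellman_min M b W e s)%E.
Proof.
move=> vV vW VW e s Xe; have [i ->] := bellman_min_attained M b W e s.
by apply: le_trans (bellman_min_le M b V e s i) _; exact: bellman_op_le.
Qed.

Lemma value_iter_radial k : radial_value (value_iter M b k).
Proof. by elim: k => [|k IH]; [split=> [|? ? ?]|exact: bellman_min_radial]. Qed.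

Lemma value_iter_function k : value_function M (value_iter M b k).
Proof. exact/radial_value_function/value_iter_radial. Qed.

Lemma value_iter_nondecreasing e s : X e ->
  {homo (fun k => value_iter M b k e s) : k l / (k <= l)%N >-> (k <= l)%E}.
Proof.
move=> Xe; apply: homo_leq => // [? ? ?|k]; first exact: le_trans.
elim: k e s Xe => [|k IH] e s Xe.
  by have [V0 _] := value_iter_radial 1; exact: V0.
by apply: (bellman_min_mono _ _ IH) => //; exact: value_iter_function.
Qed.

(** Exists in the extended reals by monotonicity; finiteness comes only from comparison with a
    real-valued solution. *)
Definition value_limit e s : \bar R := limn (fun k => value_iter M b k e s).

Lemma value_iter_cvg e s : X e ->
  value_iter M b k e s @[k --> \oo] --> value_limit e s.
Proof.
by move=> Xe; apply: ereal_nondecreasing_is_cvgn; exact: value_iter_nondecreasing.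
Qed.

Lemma value_iter_le_limit k e s : X e ->
  (value_iter M b k e s <= value_limit e s)%E.
Proof.
move=> Xe; apply: (cvge_to_ge (value_iter_cvg Xe)).
by exists k => // l /=; exact: value_iter_nondecreasing.
Qed.

Lemma value_limit_le e s (x : \bar R) : X e ->
  (forall k, value_iter M b k e s <= x)%E -> (value_limit e s <= x)%E.
Proof.
move=> Xe le_x; apply: (cvge_to_le (value_iter_cvg Xe)).
exact: nearW.
Qed.

Lemma value_limit_radial : radial_value value_limit.
Proof.
split=> [e s Xe|s x y Xx Xy xy].
  by apply: le_trans (value_iter_le_limit 0 s Xe).
apply: value_limit_le => // k; apply: le_trans (value_iter_le_limit k s Xy).
by have [_ rV] := value_iter_radial k; exact: rV.
Qed.

(** Monotone convergence handles the integrals; sums and products pass to the limit because all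
    terms are nonnegative and all weights finite. *)
Lemma bellman_op_cvg e s i : X e ->
  bellman_op M b (value_iter M b k) e s (power M i) @[k --> \oo] -->
  bellman_op M b value_limit e s (power M i).
Proof.
move=> Xe; have b0 : 0 <= b by case/andP: b01 => /ltW.
have vL := radial_value_function value_limit_radial.
have drop_cvg e' s' : X e' -> dropped_value M (value_iter M b k) e' s'
    @[k --> \oo] --> dropped_value M value_limit e' s'.
  move=> Xe'; have XD w : X w -> X (gain M * e' + w).
    move=> Xw; apply: pointsD => //; apply: pointsM => //.
    by case: Mok.
  apply: cvg_monotone_convergence.
  - exact: measurable_points.
  - by move=> k; apply: measurable_shift => //; exact: value_iter_function.
  - by move=> k w /XD; case: (value_iter_radial k) => + _; exact.
  - by move=> w /XD; exact: value_iter_nondecreasing.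
rewrite bellman_opE//.
have opE k := bellman_opE Mok b01 s i (value_iter_function k) Xe.
under eq_fun do rewrite opE.
apply: cvgeD; [by rewrite fin_num_adde_defr|exact: cvg_cst|].
have [_ _ [Q0 _] _ [[p01 _ _ _] _ _]] := Mok.
have w0 s' : 0 <= trans M s s' * pdrop M s' (power M i).
  by rewrite mulr_ge0//; case/andP: (p01 s' i).
have w0' s' : 0 <= trans M s s' * (1 - pdrop M s' (power M i)).
  by rewrite mulr_ge0// subr_ge0; case/andP: (p01 s' i).
have dc0 V s' : value_function M V -> (0 <= (trans M s s' *
    pdrop M s' (power M i))%:E * dropped_cost M b V e s')%E.
  by move=> vV; rewrite mule_ge0 ?lee_fin//; exact: dropped_cost_ge0.
have dv0 V s' : value_function M V -> (0 <= (trans M s s' *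
    (1 - pdrop M s' (power M i)))%:E * (b%:E * dropped_value M V 0%R s'))%E.
  move=> vV; rewrite !mule_ge0 ?lee_fin//; apply: dropped_value_ge0 => //.
  exact: points0.
apply: cvg_nnesum => s' _.
  apply: nearW => k; have vk := value_iter_function k.
  by rewrite adde_ge0 ?dc0 ?dv0.
apply: cvgeD; first by apply: ge0_adde_def; rewrite inE ?dc0 ?dv0.
  apply: cvgeZl => //; apply: cvgeD; [by rewrite fin_num_adde_defr|exact: cvg_cst|].
  by apply: cvgeZl => //; exact: drop_cvg.
by do 2 apply: cvgeZl => //; apply: drop_cvg; exact: points0.
Qed.

Lemma value_limit_fixpoint e s : X e ->
  value_limit e s = bellman_min M b value_limit e s.
Proof.
move=> Xe; apply/eqP; rewrite eq_le; apply/andP; split.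
  have vL := radial_value_function value_limit_radial.
  apply: value_limit_le => // k.
  apply: le_trans (value_iter_nondecreasing s Xe (leqnSn k)) _.
  apply: bellman_min_mono => //; first exact: value_iter_function.
  by move=> *; exact: value_iter_le_limit.
(* The minimizing power may vary with k; as there are finitely many powers and
   the iterates increase in k, one power serves all k. *)
suff [i le_i] : exists i, forall k,
    (bellman_op M b (value_iter M b k) e s (power M i) <= value_limit e s)%E.
  apply: le_trans (bellman_min_le _ _ _ _ _ i) _.
  by apply: (cvge_to_le (@bellman_op_cvg e s i Xe)); exact: nearW.
(* Otherwise each power i exceeds the limit at some index [K i]. At the largest of these indices all
   powers do, and hence so does the next iterate, which is the value at one of them. *)
apply/not_existsP => no_i.
have /choice [K K_lt] i : exists k,
    (value_limit e s < bellman_op M b (value_iter M b k) e s (power M i))%E.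
  by have /existsNP [k nle] := no_i i; exists k; rewrite ltNge; exact/negP.
pose k := (\max_i K i)%N.
have [i Ei] := bellman_min_attained M b (value_iter M b k) e s.
have := value_iter_le_limit k.+1 s Xe; rewrite /= Ei leNgt => /negP; apply.
apply: lt_le_trans (K_lt i) _.
apply: bellman_op_le => //; [exact: value_iter_function|exact: value_iter_function|].
move=> e' s' Xe'; apply: value_iter_nondecreasing => //.
exact: leq_bigmax.
Qed.

(** By induction every iterate lies below [J], so the limit is finite and below [J]. The limit is
    then itself a real-valued solution, and minimality of [J] gives the reverse inequality. *)
Lemma smallest_solution_radial (J : R -> 'I_n -> R) :
  smallest_solution M b J -> radial_value (fun e s => (J e s)%:E).
Proof.
move=> [[J0 mJ JE] Jmin].
have vJ : value_function M (fun e s => (J e s)%:E).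
  by split=> [e s Xe|s]; [rewrite lee_fin J0|exact/measurable_EFinP].
have le_J k e s : X e -> (value_iter M b k e s <= (J e s)%:E)%E.
  elim: k e s => [|k IH] e s Xe; first by rewrite lee_fin J0.
  rewrite JE//; apply: (bellman_min_mono _ vJ IH) => //.
  exact: value_iter_function.
have limJ e s : X e -> (value_limit e s <= (J e s)%:E)%E.
  by move=> Xe; apply: value_limit_le => // k; exact: le_J.
have [L0 rL] := value_limit_radial.
have Lfin e s : X e -> (fine (value_limit e s))%:E = value_limit e s.
  move=> Xe; rewrite fineK// ge0_fin_numE ?L0//.
  exact: le_lt_trans (limJ _ _ Xe) (ltry _).
have JL e s : X e -> (J e s)%:E = value_limit e s.
  move=> Xe; apply/eqP; rewrite eq_le limJ// andbT -Lfin// lee_fin.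
  apply: (Jmin (fun e s => fine (value_limit e s))) => //; split=> [e' s' Xe'|s'|e' s' Xe'].
  - by rewrite -lee_fin Lfin// L0.
  - apply/measurable_EFinP.
    apply: (eq_measurable_fun (value_limit ^~ s')).
      by move=> x /[!inE] Xx /=; rewrite Lfin.
    exact: radial_measurable.
  - rewrite Lfin// value_limit_fixpoint//; apply: eq_bigr => i _.
    (* [fine] is known to preserve the limit only on the error space, which is where the integrals
       are taken. *)
    congr (_ + _ * _)%E; apply: eq_bigr => s1 _; congr (_ * _)%E.
    congr (_ * _ + _ * _)%E; apply: eq_integral => w /[!inE] Xw.
      rewrite Lfin//; apply: pointsD => //; apply: pointsM => //.
      by case: Mok.
    by rewrite Lfin.
split=> [e s Xe|s x y Xx Xy xy]; first by rewrite lee_fin J0.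
by rewrite !JL//; exact: rL.
Qed.

End value_iteration.

(** * Monotone strategies and thresholds *)

(** Includes evenness, by comparing errors of equal absolute value both ways, and asks only for weak
    inequalities, which survive pointwise limits. *)
Definition monotone_strategy (R : realType) (n m : nat) (M : model R n m)
    (f : R -> 'I_n -> R) : Prop :=
  (forall e s, points R (err_space M) e -> exists i, f e s = power M i) /\
  (forall e e' s, points R (err_space M) e -> points R (err_space M) e' ->
     `|e| <= `|e'| -> f e s <= f e' s).

Lemma power_le (R : realType) (n m : nat) (M : model R n m) (i j : 'I_m.+1) :
  standing_assumptions M -> (power M i <= power M j) = (i <= j)%N.
Proof.
case=> _ _ _ [_ powS] _; apply/idP/idP; last first.
  rewrite leq_eqVlt => /orP[/eqP/val_inj -> //|/powS]; exact: ltW.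
by rewrite leqNgt leNgt; apply: contra => /powS.
Qed.

Lemma power_lt (R : realType) (n m : nat) (M : model R n m) (i j : 'I_m.+1) :
  standing_assumptions M -> (power M i < power M j) = (i < j)%N.
Proof. by move=> Mok; rewrite ltNge power_le// -ltnNge. Qed.

(** Two lower bounds whose sum leaves no slack are both attained; finiteness permits the
    cancellation. *)
Lemma lee_add_fin_split (R : realType) (x x0 y y0 : \bar R) :
  x0 \is a fin_num -> y0 \is a fin_num -> (x0 <= x)%E -> (y0 <= y)%E ->
  (x + y <= x0 + y0)%E -> (x <= x0)%E /\ (y <= y0)%E.
Proof.
move=> fx fy x0x y0y xy; split.
- by rewrite -(@leeD2rE _ y0)//; apply: le_trans xy; exact: leeD2l.
- by rewrite -(@leeD2lE _ x0)//; apply: le_trans xy; exact: leeD2r.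
Qed.

(** Suppose |e| <= |e'| but f(e) > f(e'). Submodularity, set against the optimality of each choice
    at its own error, makes both powers minimizers at both errors, and consistent tie-breaking
    forces them to be equal. *)
Lemma discounted_strategy_monotone (R : realType) (n m : nat) (M : model R n m)
    (b : R) (f : R -> 'I_n -> R) :
  standing_assumptions M -> 0 < b < 1 -> discounted_strategy M b f ->
  monotone_strategy M f.
Proof.
move=> Mok b01 [J Jsol [fmin ftie]].
have rJ := smallest_solution_radial Mok b01 Jsol.
have vJ := radial_value_function rJ; case: (rJ) => _ radJ.
have fpow e s : points R (err_space M) e -> exists i, f e s = power M i.
  by move=> /(fmin e s) [].
(* The minimum equals the real number [J e s]; this finiteness allows the submodularity inequality
   to be split. *)
have ffin e s : points R (err_space M) e ->
    bellman_rhs M b J e s (f e s) \is a fin_num.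
  move=> Xe; have [[i ->] le_i] := fmin e s Xe.
  rewrite ge0_fin_numE; last exact: (bellman_op_ge0 Mok b01 s i vJ Xe).
  have [k Ek] := bellman_min_attained M b (fun e s => (J e s)%:E) e s.
  apply: le_lt_trans (le_i k) _.
  have [[_ _ JE] _] := Jsol.
  by rewrite -[bellman_rhs _ _ _ _ _ _]Ek -[bellman_min _ _ _ _ _]JE// ltry.
split=> // e e' s Xe Xe' ee'; rewrite leNgt; apply/negP => lt_f.
have [[j fe] le_j] := fmin e s Xe; have [[i fe'] le_i] := fmin e' s Xe'.
have ij : (i <= j)%N by rewrite -(power_le _ _ Mok) -fe -fe' ltW.
have := bellman_op_submodular Mok b01 s vJ radJ Xe Xe' ee' ij.
rewrite -fe -fe' => sub.
have [le_e le_e'] : (bellman_rhs M b J e s (f e' s) <=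
    bellman_rhs M b J e s (f e s))%E /\
    (bellman_rhs M b J e' s (f e s) <= bellman_rhs M b J e' s (f e' s))%E.
  apply: lee_add_fin_split sub; rewrite ?ffin//.
  - by rewrite fe'; exact: le_j.
  - by rewrite fe; exact: le_i.
suff eq_f : f e s = f e' s by rewrite eq_f ltxx in lt_f.
apply: ftie => //; split.
- by exists i.
- by move=> k; exact: le_trans le_e (le_j k).
- by exists j.
- by move=> k; exact: le_trans le_e' (le_i k).
Qed.

Lemma limit_point_monotone (R : realType) (n m : nat) (M : model R n m)
    (F : R -> R -> 'I_n -> R) (f : R -> 'I_n -> R) :
  (forall b, 0 < b < 1 -> monotone_strategy M (F b)) ->
  limit_point_at1 (points R (err_space M)) F f -> monotone_strategy M f.
Proof.
move=> mF lim_f; split=> [e s Xe|e e' s Xe Xe' ee'].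
  apply: contrapT => /forallNP not_pow.
  (* The distance from [f e s] to the nearest power, capped at 1: no power lies closer than this. *)
  pose eps := \big[Order.min/1]_(i < m.+1) `|f e s - power M i|.
  have eps0 : 0 < eps.
    apply: lt_bigmin => // i _; rewrite normr_gt0 subr_eq0.
    exact/eqP/not_pow.
  have [x|b [_ b0 b1 near_f]] := lim_f [:: (e, s)] eps 0 eps0 ltr01.
    by rewrite inE => /eqP ->.
  have b01 : 0 < b < 1 by rewrite b0.
  have [k Fk] := (mF b b01).1 e s Xe.
  have := near_f (e, s) (mem_head _ _); rewrite /= Fk distrC ltNge => /negP; apply.
  exact: bigmin_le.
rewrite leNgt; apply/negP => lt_f.
(* If both values of [F b] are within half the gap of those of [f], they are in the same strict
   order. *)
have eps0 : 0 < (f e s - f e' s) / 2 by lra.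
have [x|b [_ b0 b1 near_f]] := lim_f [:: (e, s); (e', s)] _ 0 eps0 ltr01.
  by rewrite !inE => /orP[] /eqP ->.
have /near_f : (e, s) \in [:: (e, s); (e', s)] by rewrite inE eqxx.
have /near_f : (e', s) \in [:: (e, s); (e', s)] by rewrite !inE eqxx orbT.
have b01 : 0 < b < 1 by rewrite b0.
have := (mF b b01).2 e e' s Xe Xe' ee'.
by rewrite /= !ltr_norml => ? /andP[? ?] /andP[? ?]; lra.
Qed.

Lemma optimal_strategy_monotone (R : realType) (n m : nat) (M : model R n m)
    (beta : R) (f : R -> 'I_n -> R) :
  0 < beta <= 1 -> standing_assumptions M -> optimal_strategy M beta f ->
  monotone_strategy M f.
Proof.
move=> /andP[beta0]; rewrite le_eqVlt => /orP[/eqP beta1|beta1] Mok [fd fa].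
  have [F [dF limF]] := fa beta1.
  apply: limit_point_monotone limF => b b01.
  exact: discounted_strategy_monotone Mok b01 (dF b b01).
apply: (discounted_strategy_monotone Mok _ (fd beta1)).
by rewrite beta0.
Qed.

(** * Thresholds of a monotone strategy *)

Section thresholds.
Variables (R : realType) (n m : nat) (M : model R n m) (f : R -> 'I_n -> R).
Hypothesis Mok : standing_assumptions M.
Hypothesis mf : monotone_strategy M f.
Local Notation X := (points R (err_space M)).
Implicit Types (e x : R) (s : 'I_n) (i j : 'I_m.+1) (k l : nat).

Lemma monotone_strategy_norm e s : X e -> f `|e| s = f e s.
Proof.
case: mf => _ fmono Xe; have Xe' := points_norm Xe.
by apply/eqP; rewrite eq_le !fmono ?normr_id.
Qed.

Lemma level_setE s i : level_set M f s i =
  [set e%:E | e in [set e | [/\ X e, 0 <= e & f e s = power M i]]].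
Proof. by rewrite /level_set inord_val. Qed.

Lemma threshold_last s : threshold M f s m.+1 = +oo%E.
Proof. by rewrite /threshold subnn. Qed.

Lemma threshold_step s i : threshold M f s i =
  if level_set M f s i == set0 then threshold M f s i.+1
  else ereal_inf (level_set M f s i).
Proof. by rewrite /threshold -[in LHS](subnSK (ltn_ord i)). Qed.

(** An empty level hands over to the next, so the threshold is [+oo] or the infimum of some level
    set of index at least [k]. The induction is on the number of levels from [k] up. *)
Lemma threshold_ge s k (x : \bar R) : (k <= m.+1)%N ->
  (forall i e, (k <= i)%N -> X e -> 0 <= e -> f e s = power M i ->
    (x <= e%:E)%E) ->
  (x <= threshold M f s k)%E.
Proof.
move=> km; have [d] := ubnP (m.+1 - k); elim: d k km => // d IH k km.
rewrite ltnS => kd lbx.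
move: km; rewrite leq_eqVlt => /orP[/eqP ->|km]; first by rewrite threshold_last leey.
rewrite (threshold_step s (Ordinal km)); case: ifPn => _.
  apply: IH => //=; first by rewrite -(leq_add2r k) addSn; lia.
  by move=> i e /ltnW; exact: lbx.
rewrite level_setE; apply: le_ereal_inf_tmp => _ [e [Xe e0 fe] <-].
exact: lbx fe.
Qed.

(** An empty level shares the threshold of the next one. Otherwise monotonicity puts any point of
    level i below all points of later levels, hence below the next threshold. *)
Lemma threshold_le_succ s i : (threshold M f s i <= threshold M f s i.+1)%E.
Proof.
rewrite threshold_step level_setE; case: ifPn => [_|/set0P[y Ly]]; first exact: lexx.
case: Ly => x [Xx x0 fx] _.
apply: threshold_ge => // j e ij Xe e0 fe.
apply: (@le_trans _ _ x%:E).
  by apply: ereal_inf_lbound; exists x.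
rewrite lee_fin leNgt; apply/negP => ex.
have := mf.2 e x s Xe Xx; rewrite !ger0_norm// (ltW ex) => /(_ isT).
by rewrite fe fx (power_le _ _ Mok) leqNgt ij.
Qed.

Lemma threshold_nondecreasing s k l : (k <= l)%N -> (l <= m.+1)%N ->
  (threshold M f s k <= threshold M f s l)%E.
Proof.
elim: l => [|l IH]; first by rewrite leqn0 => /eqP ->.
rewrite leq_eqVlt => /orP[/eqP -> //|kl] lm.
by apply: le_trans (IH kl (ltnW lm)) _; exact: (threshold_le_succ s (Ordinal lm)).
Qed.

Lemma threshold_le e s i : X e -> 0 <= e -> f e s = power M i ->
  (threshold M f s i <= e%:E)%E.
Proof.
move=> Xe e0 fe; have Le : level_set M f s i e%:E by rewrite level_setE; exists e.
rewrite threshold_step; case: ifPn => [/eqP L0|_]; first by rewrite L0 in Le.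
exact: ereal_inf_lbound.
Qed.

(** Level 0 may be empty, so the upper bound goes through whichever level contains the error 0: its
    threshold is at most 0. *)
Lemma threshold0 s : threshold M f s 0 = 0%E.
Proof.
apply/eqP; rewrite eq_le; apply/andP; split; last first.
  by apply: threshold_ge => // i e _ _ e0 _; rewrite lee_fin.
have [i fi] := mf.1 0 s (points0 _ _).
apply: le_trans (threshold_le (points0 _ _) (lexx 0) fi).
by apply: threshold_nondecreasing => //; exact: ltnW.
Qed.

(** Let j be the index used at e. If j > i, threshold j is at most |e|, against the upper bound on
    |e|. If j < i, powers of index at least i occur only beyond |e|, and a positive margin there
    pushes threshold i above |e|. *)
Lemma threshold_strategy s i e : X e ->
  (threshold M f s i <= `|e|%:E < threshold M f s i.+1)%E ->
  (err_space M = Reals -> `|e|%:E = threshold M f s i ->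
     right_continuous_at (f ^~ s) `|e|) ->
  f e s = power M i.
Proof.
move=> Xe /andP[ie ei] fcont; have Xn := points_norm Xe.
have [j fj] := mf.1 e s Xe.
have fnj : f `|e| s = power M j by rewrite monotone_strategy_norm.
have [ij|ji|/val_inj -> //] := ltngtP i j.
  have := threshold_le Xn (normr_ge0 e) fnj.
  rewrite leNgt => /negP[]; apply: lt_le_trans ei _.
  by apply: threshold_nondecreasing => //; exact: ltnW.
have above (l : 'I_m.+1) x : (i <= l)%N -> X x -> 0 <= x ->
    f x s = power M l -> `|e| < x.
  move=> il Xx x0 fx; rewrite ltNge; apply/negP => xe.
  have := mf.2 x e s Xx Xe; rewrite (ger0_norm x0) xe => /(_ isT).
  by rewrite fx fj (power_le _ _ Mok) leqNgt (leq_trans ji il).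
suff [d d0 gap] : exists2 d, 0 < d & forall (l : 'I_m.+1) x, (i <= l)%N ->
    X x -> 0 <= x -> f x s = power M l -> `|e| + d <= x.
  have : ((`|e| + d)%:E <= threshold M f s i)%E.
    apply: threshold_ge; first exact: ltnW.
    by move=> l x il Xx x0 fx; rewrite lee_fin; exact: gap fx.
  by move=> /le_trans /(_ ie); rewrite lee_fin; lra.
have [EX|EX] : err_space M = Integers \/ err_space M = Reals.
- by case: (err_space M); [left|right].
(* Distinct integers are at least 1 apart. *)
- exists 1 => // l x il Xx x0 fx; have := above l x il Xx x0 fx.
  move: Xx Xn; rewrite EX => -[z _ <-] [z' _ <-].
  by rewrite ltr_int -intrD1 ler_int lezD1.
(* For real errors |e| is squeezed onto the threshold. Right-continuity then keeps f, just beyond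
   |e|, within [power M i - power M j] of [power M j], hence below every power of index at least
   i. *)
have eT : `|e|%:E = threshold M f s i.
  apply/eqP; rewrite eq_le ie andbT; apply: threshold_ge; first exact: ltnW.
  by move=> l x il Xx x0 fx; rewrite lee_fin ltW//; exact: above fx.
have lt_pow : 0 < power M i - power M j by rewrite subr_gt0 (power_lt _ _ Mok).
have /cvgrPdist_lt /(_ _ lt_pow) [d /= d0 near_e] := fcont EX eT.
exists d => // l x il Xx x0 fx; rewrite leNgt; apply/negP => xd.
have ex := above l x il Xx x0 fx.
have ball_x : `| `|e| - x| < d by rewrite distrC ger0_norm; lra.
have := near_e x ball_x ex; rewrite /= fnj fx distrC.
have : power M i <= power M l by rewrite (power_le _ _ Mok).
have : power M j < power M i by rewrite (power_lt _ _ Mok).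
by move=> ? ?; rewrite ger0_norm; lra.
Qed.

End thresholds.

(* For X = R the left end of [k^(i), k^(i+1)) belongs to the i-th piece only if
   f is right-continuous there; for X = Z there is no such condition. *)
Theorem corollary3 (R : realType) (n m : nat) (M : model R n m) (beta : R)
    (f : R -> 'I_n -> R)
    (beta_range : 0 < beta <= 1)
    (M_assumptions : standing_assumptions M)
    (M_bounded : bounded_distortion M beta)
    (Q_monotone : stochastically_monotone (trans M))
    (f_optimal : optimal_strategy M beta f) :
  [/\ forall s, threshold M f s 0 = 0%E,
      forall s (i : 'I_m.+1), (threshold M f s i <= threshold M f s i.+1)%E &
      forall s (i : 'I_m.+1) (e : R), points R (err_space M) e ->
        (threshold M f s i <= `|e|%:E < threshold M f s i.+1)%E ->
        (err_space M = Reals -> `|e|%:E = threshold M f s i ->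
           right_continuous_at (f ^~ s) `|e|) ->
        f e s = power M i].
Proof.
have mf := optimal_strategy_monotone beta_range M_assumptions f_optimal.
split=> [s|s i|s i e]; first exact: threshold0.
  exact: threshold_le_succ.
exact: threshold_strategy.
Qed.
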